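(* Let $(T_n)_{n\ge 1}$ be a uniform random recursive tree, and let $H_K$ be the set of the top $K$ most central vertices of $T_n$ according to betweenness centrality. There exists a constant $C>0$ such that for every $\varepsilon>0$, if $K=C/\varepsilon$, then $$\liminf_{n\to\infty}\mathbb{P}(1\in H_K)\ge 1-\varepsilon.$$
   Context: A uniform random recursive tree (URRT) is a random sequence of trees $(T_n)_{n\ge 1}$ with $V(T_n)=[n]=\{1,\ldots,n\}$: $T_1$ is the single vertex $1$ (the root), and $T_{n+1}$ is obtained from $T_n$ by adding vertex $n+1$ and an edge $\{i,n+1\}$, where $i$ is chosen uniformly at random from $[n]$, independently of the past. The betweenness centrality of $v\in V(T_n)$ is $\mathcal{B}_{T_n}(v)=\sum_{s,t\in V(T_n):\,s,t\ne v}\mathbf{1}_{\{v\in\sigma_{s,t}\}}$, where $\sigma_{s,t}$ is the path between $s$ and $t$ in $T_n$ excluding $s$ and $t$; larger values correspond to more central vertices. Ranking: vertices are ordered from most to least central; vertices with equal centrality value are ordered in reverse order of insertion time (if $u,v$ have equal centrality, $u$ is ranked before $v$ iff $u>v$). This gives a permutation $\gamma_n$ of $[n]$, where $\gamma_n(v)\in\{1,\ldots,n\}$ is the position of $v$ in this order (position $1$ being most central). For $K>0$, $H_K=H_K(n)=\{v\in V(T_n):\gamma_n(v)\le K\}$. *)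

(* Defs.v *)
From HB Require Import structures.
From mathcomp Require Import all_boot all_order all_algebra.
From mathcomp Require Import all_classical all_reals all_analysis.

Set Implicit Arguments.
Unset Strict Implicit.
Unset Printing Implicit Defensive.

Import Order.TTheory GRing.Theory Num.Theory.

Local Open Scope classical_set_scope.
Local Open Scope nat_scope.

(* A graph on [n] = {1, ..., n} is encoded by its symmetric adjacency relation
   on nat, which is false outside [n]; the number of vertices is carried
   separately. *)

Definition empty_graph : rel nat := fun _ _ => false.

Definition add_edge (e : rel nat) (i j : nat) : rel nat :=
  fun u v => [|| e u v, (u == i) && (v == j) | (u == j) && (v == i)].

Section URRT.
Context {d : measure_display} {Omega : measurableType d} {R : realType}.
Variables (P : probability Omega R) (T : nat -> Omega -> rel nat).

(* The sigma-algebra generated by T_1, ..., T_n. Each T_m takes finitely many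
   values, so the events {T_m = t} generate it. *)
Definition past (n : nat) : set (set Omega) :=
  <<s [set A | exists m (t : rel nat),
         1 <= m <= n /\ A = [set w | T m w = t]] >>.

(* T 0 is irrelevant; X n is the vertex of T_n to which n+1 is attached. *)
Definition is_URRT : Prop :=
  (forall w, T 1 w = empty_graph) /\
  exists X : nat -> {RV P >-> nat}, forall n, 1 <= n ->
    [/\ forall w, 1 <= X n w <= n,
        forall w, T n.+1 w = add_edge (T n w) (X n w) n.+1,
        forall k, 1 <= k <= n -> P (X n @^-1` [set k]) = ((n%:R : R)^-1)%:E
      & forall (k : nat) (A : set Omega), past n A ->
          P ((X n @^-1` [set k]) `&` A) = (P (X n @^-1` [set k]) * P A)%E].

End URRT.

Definition simple_path (e : rel nat) (s t : nat) (p : seq nat) : bool :=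
  [&& path e s p, uniq (s :: p) & last s p == t].

(* In a tree exactly one p satisfies simple_path e s t p. *)
Definition path_interior (e : rel nat) (s t : nat) : set nat :=
  [set v | exists p, [/\ simple_path e s t p, v \in s :: p, v != s & v != t]].

Definition betweenness (n : nat) (e : rel nat) (v : nat) : nat :=
  \sum_(1 <= s < n.+1 | s != v) \sum_(1 <= t < n.+1 | t != v)
    `[< path_interior e s t v >].

(* Decreasing betweenness; among ties, the most recently inserted comes first. *)
Definition ranked_before (n : nat) (e : rel nat) : rel nat := fun u v =>
  (betweenness n e v < betweenness n e u) ||
  ((betweenness n e u == betweenness n e v) && (v <= u)).

Definition ranking (n : nat) (e : rel nat) : seq nat :=
  sort (ranked_before n e) (iota 1 n).

Definition rank (n : nat) (e : rel nat) (v : nat) : nat :=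
  (index v (ranking n e)).+1.

Definition top_central {R : realType} (n : nat) (e : rel nat) (K : R) : set nat :=
  [set v | 1 <= v <= n /\ ((rank n e v)%:R <= K)%R].

(* Main.v *)
(* A vertex [u <> 1] ranked before the root satisfies
   [2 (R - 1) W <= B(1) <= B(u) <= 2 n S_u], where [S_u] is the size of the
   subtree of [u], [W] that of the subtree of vertex 2, and [R = n - W]: paths
   between the subtree of 2 and the rest pass through 1, and paths through [u]
   have an endpoint below [u]. Let [h] be about [K / 2]. As [W] is uniform on
   [1, n - 1], both [W] and [R - 1] are at least [n / h] except with probability
   [O(1 / h)]. The first [h] vertices contribute at most [h] to the rank of the
   root. For a later [u] ranked before the root, [S_u >= n / (4 h)], and, after
   removal of the subtree of [u], the split of the remaining vertices is uniform
   given [S_u], hence is so unbalanced with probability [O(S_u / n)] only. The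
   probability that [u] is ranked before the root while [W] and [R - 1] are
   large is thus [O(h E[S_u^2] / n^2) = O(h / u^2)]. Summed over [u > h] this is
   [O(1)], and Markov's inequality at level [h] gives [O(1 / h)], without the
   logarithmic loss of a bound on [S_u] alone. *)

Require Import Defs.
From HB Require Import structures.
From mathcomp Require Import all_boot all_order all_algebra.
From mathcomp Require Import all_classical all_reals all_analysis.
From mathcomp Require Import zify ring lra.

Import Order.TTheory GRing.Theory Num.Theory.
Local Open Scope classical_set_scope.
Local Open Scope ring_scope.

(** * Recursive trees and betweenness *)

Section Codes.
Local Open Scope nat_scope.
Implicit Types (x : seq nat) (u v : nat).

(* [x] lists the vertices to which n, n - 1, ..., 2 are attached, in this order;
   hence n = size x + 1. *)
Fixpoint tree x : rel nat :=
  if x is k :: x' then add_edge (tree x') k (size x').+2 else empty_graph.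

Fixpoint valid_code x : bool :=
  if x is k :: x' then (0 < k <= (size x').+1) && valid_code x' else true.

(* [v] belongs to the subtree of [u], for [2 <= u <= n]. *)
Fixpoint desc u x v : bool :=
  if x is k :: x' then
    if v == (size x').+2 then (v == u) || desc u x' k else desc u x' v
  else false.

Lemma tree_bound x a b : valid_code x -> tree x a b ->
  (0 < a <= (size x).+1) && (0 < b <= (size x).+1).
Proof.
elim: x => [//|k x IH] /= /andP[kb /IH{}IH].
rewrite /add_edge => /or3P[/IH|/andP[/eqP-> /eqP->]|/andP[/eqP-> /eqP->]]; lia.
Qed.

Lemma tree_sym x a b : tree x a b = tree x b a.
Proof.
elim: x => [//|k x IH] /=; rewrite /add_edge IH.
by congr (_ || _); rewrite orbC; congr (_ || _); rewrite andbC.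
Qed.

Lemma desc_early u x v : (size x).+1 < u -> desc u x v = false.
Proof.
elim: x v => [//|k x IH] v /= xu; rewrite !IH //; try lia.
by case: eqP => [->|//]; rewrite orbF; lia.
Qed.

Lemma desc_self u x : 1 < u <= (size x).+1 -> desc u x u.
Proof.
elim: x => [|k x IH] /= ux; first by lia.
by case: ifP => [_|/eqP ne]; [rewrite eqxx | apply: IH; lia].
Qed.

Lemma desc_root u x : desc u x 1 = false.
Proof. by elim: x. Qed.

Lemma desc_2 u x : 2 < u -> desc u x 2 = false.
Proof.
move=> u2; elim: x => [//|k x IH] /=; case: ifP => // /eqP [] /esym/size0nil ->.
by rewrite orbF; lia.
Qed.

(** Every later vertex falls on the same side as the vertex it is attached to, so the edge created
    together with [u] stays the only one leaving its subtree. *)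
Lemma desc_cut u x : valid_code x -> 1 < u <= (size x).+1 ->
  exists pi : nat, [/\ pi != u, u = 2 -> pi = 1 &
    forall a b, tree x a b -> desc u x a -> ~~ desc u x b -> a = u /\ b = pi].
Proof.
elim: x => [|k x IH] /=; first by lia.
move=> /andP[kb cx] ux.
have [uN|uN] := eqVneq u (size x).+2.
  exists k; split; try lia.
  move=> a b; rewrite -uN !(desc_early u x) ?uN //.
  move=> /or3P[/(tree_bound _ _ _ cx)|/andP[/eqP-> /eqP->]|/andP[/eqP-> /eqP->]] //.
    by move=> abb; rewrite ifN //; lia.
  by rewrite ifN //; lia.
have [|pi [piu pi2 cut]] := IH cx; first by lia.
exists pi; split=> // a b /or3P[ab|/andP[/eqP-> /eqP->]|/andP[/eqP-> /eqP->]].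
- have abb := tree_bound _ _ _ cx ab.
  rewrite !ifN; [exact: cut|lia|lia].
- by rewrite eqxx (negbTE (_ : k != _)); [rewrite eq_sym (negbTE uN) /= => ->|lia].
- by rewrite eqxx (negbTE (_ : k != _)); [rewrite eq_sym (negbTE uN) /= => ->|lia].
Qed.

(** The first step at which [D] changes value is such an edge. Membership of [a] and [b] is recorded
    in order to locate the cut vertex on the path. *)
Lemma path_crossing (e : rel nat) (D : pred nat) s p :
  path e s p -> D s != D (last s p) ->
  exists a b, [/\ e a b, D a = D s, D b = D (last s p),
                  a \in belast s p & b \in p].
Proof.
elim: p s => [|y p IH] s /=; first by rewrite eqxx.
move=> /andP[sy yp] Ds.
have [sDy|sDy] := eqVneq (D s) (D y).
  have [|a [b [ab Da Db ap bp]]] := IH y yp; first by rewrite -sDy.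
  by exists a, b; rewrite !inE ap bp !orbT Da sDy.
exists s, y; rewrite !inE !eqxx; split=> //.
by move: Ds sDy; case: (D s); case: (D y); case: (D _).
Qed.

(* A path entering and leaving the subtree of [u] would visit the parent of [u]
   twice. *)
Lemma path_interior_desc u x s t : valid_code x -> 1 < u <= (size x).+1 ->
  path_interior (tree x) s t u -> desc u x s || desc u x t.
Proof.
move=> cx ux [p [/and3P[sp up /eqP lt]]].
have [pi [piu _ cut]] := desc_cut _ _ cx ux.
have Du := desc_self _ _ ux.
rewrite inE => /orP[->//|pu us ut]; apply: contraT.
rewrite negb_or => /andP[nDs nDt].
case/splitPr: pu sp up lt => p1 p2; rewrite cat_path last_cat /=.
move=> /and3P[sp1 l1u up2] /= /andP[snp]; rewrite cat_uniq /= => /and3P[_ hp _] lt.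
have [||a [b [ab Da Db]]] := @path_crossing (tree x) (desc u x) s (rcons p1 u).
- by rewrite rcons_path sp1.
- by rewrite last_rcons Du (negbTE nDs).
rewrite last_rcons Du in Db; rewrite belast_rcons => ap1 _.
have [_ api] : b = u /\ a = pi.
  by apply: cut; rewrite ?Db // ?Da // tree_sym.
have [|a' [b' [ab' Da' Db' _]]] := @path_crossing (tree x) (desc u x) u p2 up2.
  by rewrite lt Du (negbTE nDt).
have [_ -> pip2] : a' = u /\ b' = pi.
  by apply: cut; rewrite ?Da' // Db' lt.
move: ap1; rewrite api inE => /orP[/eqP ps|pip1].
  by move: snp; rewrite mem_cat inE -ps pip2 !orbT.
by move: hp; rewrite negb_or => /andP[_ /hasPn/(_ _ pip2)] /=; rewrite pip1.
Qed.

Lemma tree_connected x s t : valid_code x ->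
  0 < s <= (size x).+1 -> 0 < t <= (size x).+1 ->
  exists2 p, path (tree x) s p & last s p = t.
Proof.
elim: x s t => [|k x IH] s t /=; first by exists [::] => //=; lia.
move=> /andP[kb cx] sb tb; set e := add_edge _ _ _.
have sube : subrel (tree x) e by move=> a b ab; rewrite /e /add_edge ab.
have kN : e k (size x).+2 by rewrite /e /add_edge !eqxx orbT.
have Nk : e (size x).+2 k by rewrite /e /add_edge !eqxx !orbT.
have [->|sN] := eqVneq s (size x).+2; have [->|tN] := eqVneq t (size x).+2.
- by exists [::].
- have [||p kp <-] := IH k t cx; [lia|lia|].
  by exists (k :: p) => //=; rewrite Nk (sub_path sube).
- have [||p sp lk] := IH s k cx; [lia|lia|].
  exists (rcons p (size x).+2); rewrite ?last_rcons //.
  by rewrite rcons_path (sub_path sube) // lk.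
- have [||p sp lk] := IH s t cx; [lia|lia|].
  by exists p => //; rewrite (sub_path sube).
Qed.

(** The only edge between the subtree of 2 and the rest is {1, 2}, so a path joining the two sides
    visits 1. *)
Lemma path_interior_root x s t : valid_code x -> s != 1 -> t != 1 ->
  0 < s <= (size x).+1 -> 0 < t <= (size x).+1 ->
  desc 2 x s != desc 2 x t -> path_interior (tree x) s t 1.
Proof.
move=> cx s1 t1 sb tb Dst.
have [p0 sp0 lt0] := tree_connected _ _ _ cx sb tb.
move: lt0; case: (shortenP sp0) => p sp up _ lt.
exists p; rewrite eq_sym s1 eq_sym t1 /simple_path sp up lt eqxx; split=> //.
have x2 : 1 < 2 <= (size x).+1.
  by move: sb s1; lia.
have [pi [_ /(_ erefl) -> cut]] := desc_cut _ _ cx x2.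
have [|a [b [ab Da Db ap bp]]] := @path_crossing (tree x) (desc 2 x) s p sp.
  by rewrite lt.
have : 1 = a \/ 1 = b.
  move: Da Db Dst; rewrite lt; case: (desc 2 x s); case: (desc 2 x t) => //.
    by move=> Da Db _; right; rewrite (proj2 (cut _ _ ab _ _)) ?Da ?Db.
  move=> Da Db _; left; rewrite tree_sym in ab.
  by rewrite (proj2 (cut _ _ ab _ _)) ?Da ?Db.
by case=> ->; [exact: mem_belast | rewrite inE bp orbT].
Qed.

Definition subtree_size u x : nat := \sum_(1 <= v < (size x).+2) desc u x v.

Lemma betweenness_le u x : valid_code x -> 1 < u <= (size x).+1 ->
  betweenness (size x).+1 (tree x) u <= 2 * (size x).+1 * subtree_size u x.
Proof.
move=> cx ux; rewrite /betweenness.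
apply: (@leq_trans (\sum_(1 <= s < (size x).+2) \sum_(1 <= t < (size x).+2)
  (desc u x s + desc u x t))).
  rewrite big_mkcond /=; apply: leq_sum => s _; case: ifP => // _.
  rewrite big_mkcond /=; apply: leq_sum => t _; case: ifP => // _.
  case: asboolP => // /path_interior_desc -/(_ cx ux).
  by case: (desc u x s); case: (desc u x t).
under eq_bigr do rewrite big_split /= sum_nat_const_nat.
rewrite big_split /= sum_nat_const_nat -big_distrr /= -/(subtree_size u x).
by rewrite subn1 /=; lia.
Qed.

(** [size x - W] is the number of non-root vertices outside the subtree of 2. Each ordered pair with
    one endpoint on either side counts, hence the factor 2. *)
Lemma betweenness_root_ge x : valid_code x ->
  2 * (subtree_size 2 x * (size x - subtree_size 2 x)) <=
  betweenness (size x).+1 (tree x) 1.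
Proof.
move=> cx; rewrite /betweenness.
set W := subtree_size 2 x.
have WE : W = \sum_(1 <= s < (size x).+2 | s != 1) desc 2 x s.
  rewrite [RHS]big_mkcond /= /W /subtree_size; apply: eq_bigr => s _.
  by case: eqP => [->|//]; rewrite desc_root.
have RE : size x - W = \sum_(1 <= s < (size x).+2 | s != 1) ~~ desc 2 x s.
  have : W + \sum_(1 <= s < (size x).+2 | s != 1) ~~ desc 2 x s = size x.
    rewrite WE -big_split /= (eq_bigr (fun=> 1)); last by move=> i _; case: desc.
    rewrite big_ltn_cond // eqxx /= big_nat_cond.
    rewrite (eq_bigl (fun i => (1 < i < (size x).+2))); last by move=> i; lia.
    by rewrite -big_nat sum_nat_const_nat; lia.
  by lia.
apply: (@leq_trans (\sum_(1 <= s < (size x).+2 | s != 1)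
    \sum_(1 <= t < (size x).+2 | t != 1)
     (desc 2 x s * ~~ desc 2 x t + ~~ desc 2 x s * desc 2 x t))); last first.
  rewrite big_nat_cond [leqRHS]big_nat_cond; apply: leq_sum => s /andP[sb s1].
  rewrite big_nat_cond [leqRHS]big_nat_cond; apply: leq_sum => t /andP[tb t1].
  have [->|ne] := eqVneq (desc 2 x s) (desc 2 x t); first by case: desc.
  rewrite (asboolT (path_interior_root _ _ _ cx s1 t1 sb tb ne)).
  by case: (desc 2 x s); case: (desc 2 x t).
under eq_bigr do rewrite big_split /= -!big_distrr /= -WE -RE.
rewrite big_split /= -!big_distrl /= -WE -RE; lia.
Qed.

(** Every vertex up to the position of [v] in the sorted list has betweenness at least that of [v].
    Ties are counted in full, so the tie-breaking rule does not enter the bound. *)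
Lemma rank_le_count n e v : 0 < v <= n ->
  rank n e v <= \sum_(1 <= u < n.+1) (betweenness n e v <= betweenness n e u).
Proof.
move=> vn; rewrite /rank.
have rtot : total (ranked_before n e).
  by move=> a b; rewrite /ranked_before; lia.
have rtr : transitive (ranked_before n e).
  by move=> a b c; rewrite /ranked_before; lia.
have rrefl : reflexive (ranked_before n e).
  by move=> a; rewrite /ranked_before; lia.
set s := ranking n e.
have ss : sorted (ranked_before n e) s by exact: sort_sorted.
have vs : v \in s by rewrite mem_sort mem_iota; lia.
apply: (@leq_trans (count (ranked_before n e ^~ v) s)); last first.
  rewrite /s /ranking (permP (permEl (perm_sort _ _))) -sum1_count.
  rewrite /index_iota subn1 /= big_mkcond /=; apply: leq_sum => u _.
  by rewrite /ranked_before; case: ifP => //; lia.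
rewrite -[X in count _ X](cat_take_drop (index v s).+1 s) count_cat.
apply: leq_trans (leq_addr _ _).
have iv : index v s < size s by rewrite index_mem.
have -> : count (ranked_before n e ^~ v) (take (index v s).+1 s) =
          size (take (index v s).+1 s).
  apply/eqP; rewrite -all_count; apply/allP => u /(nthP 0)[i].
  rewrite size_takel // => isz <-; rewrite nth_take //.
  have := sorted_leq_nth rtr rrefl 0 ss i (index v s).
  by rewrite nth_index // !inE; apply => //; exact: leq_trans isz iv.
by rewrite size_takel.
Qed.

End Codes.

(** * Sizes of the parts cut out by the subtrees of [u] and 2 *)

Section Counts.
Local Open Scope nat_scope.
Implicit Types (x : seq nat) (u v k : nat).

(** The root's side of the split made by the edge {1, 2} once the subtree of [u] is removed. For [u]
    beyond the last vertex it has size R. *)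
Definition outer_size u x : nat :=
  \sum_(1 <= v < (size x).+2) (~~ desc u x v && ~~ desc 2 x v).

Lemma subtree_size_cons u x k :
  subtree_size u (k :: x) = subtree_size u x + (((size x).+2 == u) || desc u x k).
Proof.
rewrite /subtree_size big_nat_recr //= eqxx; congr (_ + _).
rewrite big_nat [RHS]big_nat; apply: eq_bigr => v vx; rewrite !ifN //; lia.
Qed.

Lemma outer_size_cons u x k : 0 < size x -> (size x).+2 != u ->
  outer_size u (k :: x) = outer_size u x + (~~ desc u x k && ~~ desc 2 x k).
Proof.
move=> x0 xu.
have x2 : ((size x).+2 == 2) = false by lia.
rewrite /outer_size big_nat_recr //= eqxx (negbTE xu) x2; congr (_ + _).
rewrite big_nat [RHS]big_nat; apply: eq_bigr => v vx; rewrite !ifN //; lia.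
Qed.

Lemma outer_size_early u x k : (size x).+2 = u -> 0 < size x ->
  outer_size u (k :: x) = outer_size u x.
Proof.
move=> xu x0; rewrite /outer_size big_nat_recr //= eqxx xu eqxx /= addn0.
rewrite big_nat [RHS]big_nat; apply: eq_bigr => v vx; rewrite !ifN //; lia.
Qed.

Lemma subtree_size_early u x : (size x).+1 < u -> subtree_size u x = 0.
Proof. by move=> xu; rewrite /subtree_size big1 // => v _; rewrite desc_early. Qed.

(** Vertices 1 and 2 are never below [u]. The strict inequality keeps the range of the uniform law
    below nonempty. *)
Lemma subtree_size_lt u x : 2 < u -> 0 < size x -> subtree_size u x < size x.
Proof.
move=> u2 x0; rewrite /subtree_size big_ltn // desc_root big_ltn // desc_2 //.
rewrite !add0n; apply: (@leq_ltn_trans (\sum_(3 <= v < (size x).+2) 1)).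
  by apply: leq_sum => v _; case: desc.
by rewrite sum_nat_const_nat; lia.
Qed.

Lemma sizes_partition u x :
  subtree_size u x + outer_size u x +
  \sum_(1 <= v < (size x).+2) (~~ desc u x v && desc 2 x v) = (size x).+1.
Proof.
rewrite /subtree_size /outer_size -!big_split /=.
rewrite (eq_bigr (fun=> 1)); last by move=> v _; do 2 case: desc.
by rewrite sum_nat_const_nat; lia.
Qed.

Lemma outer_size_le u x : subtree_size 2 x + outer_size u x <= (size x).+1.
Proof.
rewrite /subtree_size /outer_size -!big_split /=.
apply: (@leq_trans (\sum_(1 <= v < (size x).+2) 1)); last first.
  by rewrite sum_nat_const_nat; lia.
by apply: leq_sum => v _; do 2 case: desc.
Qed.

(** The left-hand side counts the part of the subtree of 2 that lies outside that of [u]. *)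
Lemma inner_size_le u x :
  (size x).+1 - subtree_size u x - outer_size u x <= subtree_size 2 x.
Proof.
rewrite -(sizes_partition u x) -addnA addKn addKn.
by rewrite /subtree_size; apply: leq_sum => v _; do 2 case: desc.
Qed.

End Counts.

(** * Averages over recursive trees *)

Section Expectation.
Context {R : realType}.
Implicit Types (f g : seq nat -> R) (m u : nat).

(** Expectation over the code of a uniform recursive tree on m + 1 vertices, the last attachment
    being averaged first, given the earlier ones. *)
Fixpoint ev m f : R :=
  if m is m'.+1 then
    ev m' (fun x => (\sum_(1 <= k < m.+1) f (k :: x)) / m%:R)
  else f [::].

Lemma evS m f :
  ev m.+1 f = ev m (fun x => (\sum_(1 <= k < m.+2) f (k :: x)) / m.+1%:R).
Proof. by []. Qed.

Lemma ev_le m f g : (forall x, valid_code x -> size x = m -> f x <= g x) -> ev m f <= ev m g.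
Proof.
elim: m f g => [|m IH] f g fg /=; first exact: fg.
apply: IH => x cx xm; rewrite ler_pM2r ?invr_gt0 ?ltr0n // big_nat [leRHS]big_nat.
by apply: ler_sum => k kb; apply: fg; rewrite /= ?cx ?xm ?andbT.
Qed.

Lemma eq_ev m f g : (forall x, valid_code x -> size x = m -> f x = g x) -> ev m f = ev m g.
Proof.
by move=> fg; apply/eqP; rewrite eq_le !ev_le // => x cx xm; rewrite fg.
Qed.

Lemma ev_sum m I (r : seq I) (P : pred I) (F : I -> seq nat -> R) :
  ev m (fun x => \sum_(i <- r | P i) F i x) = \sum_(i <- r | P i) ev m (F i).
Proof.
elim: m F => [//|m IH] F /=; rewrite -IH; apply: eq_ev => x _ _.
by rewrite exchange_big /= big_distrl.
Qed.

Lemma evZ m c f : ev m (fun x => c * f x) = c * ev m f.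
Proof.
elim: m f => [//|m IH] f /=; rewrite -IH; apply: eq_ev => x _ _.
by rewrite mulrA big_distrr.
Qed.

Lemma evD m f g : ev m (fun x => f x + g x) = ev m f + ev m g.
Proof.
elim: m f g => [//|m IH] f g /=; rewrite -IH; apply: eq_ev => x _ _.
by rewrite -mulrDl big_split.
Qed.

Lemma mean_cst m (c : R) : (\sum_(1 <= k < m.+2) c) / m.+1%:R = c.
Proof. by rewrite sumr_const_nat subn1 /= -[c *+ _]mulr_natr mulfK // pnatr_eq0. Qed.

Lemma ev_cst m (c : R) : ev m (fun=> c) = c.
Proof.
elim: m => [//|m IH] /=; rewrite -[RHS]IH; apply: eq_ev => x _ _.
exact: mean_cst.
Qed.

(* One step of the three-colour urn formed by the subtree of [u], the rest of
   the subtree of [2], and the rest of the tree. *)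
Lemma urn_step u x (F : nat -> nat -> R) : (0 < size x)%N -> (size x).+2 != u ->
  let s := subtree_size u x in let r := outer_size u x in
  \sum_(1 <= k < (size x).+2) F (subtree_size u (k :: x)) (outer_size u (k :: x)) =
  s%:R * F s.+1 r + r%:R * F s r.+1 + ((size x).+1%:R - s%:R - r%:R) * F s r.
Proof.
move=> x0 xu s r.
have part : (size x).+1%:R - s%:R - r%:R =
    (\sum_(1 <= k < (size x).+2) (~~ desc u x k && desc 2 x k))%:R :> R.
  have /(congr1 (fun i : nat => i%:R : R)) := sizes_partition u x.
  by rewrite /= 2!natrD -/s -/r => <-; ring.
have sE : s%:R * F s.+1 r =
    \sum_(1 <= k < (size x).+2) (desc u x k)%:R * F s.+1 r.
  by rewrite -big_distrl -natr_sum.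
have rE : r%:R * F s r.+1 =
    \sum_(1 <= k < (size x).+2) (~~ desc u x k && ~~ desc 2 x k)%:R * F s r.+1.
  by rewrite -big_distrl -natr_sum.
rewrite part sE rE natr_sum big_distrl -!big_split; apply: eq_bigr => k _.
rewrite subtree_size_cons outer_size_cons // (negbTE xu) -/s -/r.
by case: (desc u x k); case: (desc 2 x k); rewrite /= ?addn0 ?addn1; ring.
Qed.

(** In a two-colour Polya urn with M + 1 balls, a count uniform on [1, M] becomes uniform on
    [1, M + 1] after one draw; here both sides are multiplied by M(M + 1). *)
Lemma sum_urn_uniform (f : nat -> R) M :
  \sum_(1 <= r < M.+1) (r%:R * f r.+1 + (M.+1%:R - r%:R) * f r) =
  M%:R * \sum_(1 <= r < M.+2) f r.
Proof.
elim: M => [|M IH]; first by rewrite big_geq // mul0r.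
rewrite big_nat_recr //= (eq_bigr (fun r =>
  (r%:R * f r.+1 + (M.+1%:R - r%:R) * f r) + f r)); last first.
  by move=> r _; rewrite [M.+2%:R]mulrSr; ring.
rewrite big_split /= IH [in RHS]big_nat_recr //= [\sum_(1 <= r < M.+2) f r]big_nat_recr //=.
by rewrite [M.+2%:R]mulrSr [M.+1%:R]mulrSr; ring.
Qed.

(* Conditionally on the size [s] of the subtree of [u], the size of the part of
   the tree outside the subtrees of [u] and [2] is uniform on [1, n - s - 1],
   where [n = m + 1] is the number of vertices. *)
Lemma outer_size_uniform m u (F : nat -> nat -> R) : (2 < u)%N -> (0 < m)%N ->
  ev m (fun x => F (subtree_size u x) (outer_size u x)) =
  ev m (fun x => (\sum_(1 <= r < (m - subtree_size u x).+1) F (subtree_size u x) r)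
                 / (m - subtree_size u x)%:R).
Proof.
move=> u2; elim: m F => [//|n IH] F _; have [->|n0] := posnP n.
  apply: eq_ev => -[|k [|//]] //= kb _.
  have s0 : subtree_size u [:: k] = 0%N by apply: subtree_size_early.
  rewrite s0 subn0 big_nat1 invr1 mulr1; congr F.
  by rewrite /outer_size 2?big_ltn //= !big_geq //= [2 == u]ltn_eqF.
rewrite !evS.
(* Insertion of [u]: its subtree gets size 1, and the outer part is that of the previous tree, where
   the subtree of [u] was empty. *)
have [nu|nu] := eqVneq n.+2 u.
  transitivity (ev n (fun x => F 1%N (outer_size u x))).
    apply: eq_ev => x cx xn.
    rewrite (eq_bigr (fun=> F 1%N (outer_size u x))); last first.
      move=> k _; rewrite subtree_size_cons subtree_size_early ?xn ?nu ?eqxx; last by lia.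
      by rewrite outer_size_early ?xn.
    exact: mean_cst.
  rewrite (IH (fun _ r => F 1%N r)) //; apply: eq_ev => x cx xn.
  rewrite subtree_size_early ?xn ?nu; last by lia.
  rewrite subn0 [in RHS](eq_bigr (fun=> (\sum_(1 <= r < n.+1) F 1%N r) / n%:R)); last first.
    move=> k _; rewrite subtree_size_cons subtree_size_early ?xn ?nu ?eqxx; last by lia.
    by rewrite add0n subSS subn0.
  by rewrite -nu mean_cst.
(* The average over one urn step as a function of the sizes before it, to which the induction
   hypothesis applies. *)
pose F' s r : R :=
  (s%:R * F s.+1 r + r%:R * F s r.+1 + (n.+1%:R - s%:R - r%:R) * F s r) / n.+1%:R.
transitivity (ev n (fun x => F' (subtree_size u x) (outer_size u x))).
  by apply: eq_ev => x cx xn; rewrite -xn urn_step ?xn.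
rewrite IH //; apply: eq_ev => x cx xn.
pose G s (_ : nat) : R := (\sum_(1 <= r < (n.+1 - s).+1) F s r) / (n.+1 - s)%:R.
rewrite [in RHS](eq_bigr (fun k => G (subtree_size u (k :: x)) (outer_size u (k :: x)))) //.
rewrite -[in RHS]xn urn_step ?xn //.
have : (subtree_size u x < n)%N by rewrite -xn subtree_size_lt ?xn.
set s := subtree_size u x => sn.
rewrite /F' /G -big_distrl /= subSS subSn ?(ltnW sn) //.
(* Draws outside the subtree of [u] act on a two-colour urn with [(n - s).+1] balls. *)
rewrite (eq_bigr (fun r => s%:R * F s.+1 r +
  (r%:R * F s r.+1 + ((n - s).+1%:R - r%:R) * F s r))); last first.
  by move=> r _; rewrite -subSn ?(ltnW sn) // natrB ?addrA //; lia.
rewrite big_split /= sum_urn_uniform -big_distrr /=.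
have ns0 : (n - s)%:R != 0 :> R by rewrite pnatr_eq0; lia.
have -> : n.+1%:R = (n - s).+1%:R + s%:R :> R by rewrite -natrD; congr (_%:R); lia.
have ns1 : (n - s).+1%:R + s%:R != 0 :> R by rewrite -natrD pnatr_eq0; lia.
have ns2 : (n - s).+1%:R != 0 :> R by rewrite pnatr_eq0.
move: ns1 ns2; rewrite mulrSr => ns1 ns2.
by field; rewrite ns0 ns1 ns2.
Qed.

(** With N the current number of vertices, a draw multiplies S(S + 1) by (N + 2)/N on average. So
    S(S + 1)/(N(N + 1)) is a martingale once [u] is inserted, with initial value 2/(u(u + 1));
    before that S = 0. *)
Lemma subtree_size_moment2 m u : (2 < u)%N -> (0 < m)%N ->
  ev m (fun x => (subtree_size u x)%:R * (subtree_size u x).+1%:R) <=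
  2 * (m.+1%:R * m.+2%:R) / (u%:R * u.+1%:R).
Proof.
move=> u2; elim: m => [//|n IH] _; have [->|n0] := posnP n.
  rewrite (eq_ev _ _ (fun=> 0)); first by rewrite ev_cst divr_ge0 // mulr_ge0.
  by move=> x _ x1; rewrite subtree_size_early ?mul0r ?x1.
rewrite evS.
pose F s (_ : nat) : R := s%:R * s.+1%:R.
have [nu|nu] := eqVneq n.+2 u.
  rewrite (eq_ev _ _ (fun=> 2)).
    by rewrite ev_cst nu mulfK // mulf_neq0 ?pnatr_eq0 //; lia.
  move=> x _ xn; rewrite (eq_bigr (fun=> 2)); last first.
    move=> k _; rewrite subtree_size_cons subtree_size_early ?xn ?nu ?eqxx /=; last by lia.
    by rewrite add0n mul1r.
  exact: mean_cst.
rewrite (eq_ev _ _ (fun x => (n.+3%:R / n.+1%:R) *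
   ((subtree_size u x)%:R * (subtree_size u x).+1%:R))); last first.
  move=> x _ xn; have := urn_step u x F.
  rewrite xn => /(_ n0 nu) /= ->; rewrite /F.
  rewrite -[n.+3]addn2 -[(subtree_size u x).+2]addn2 -[(subtree_size u x).+1]addn1 !natrD.
  by field; rewrite nat1r pnatr_eq0.
rewrite evZ; apply: le_trans (ler_wpM2l _ (IH n0)) _; first by rewrite divr_ge0.
have n1 : n.+1%:R != 0 :> R by rewrite pnatr_eq0.
have u0 : u%:R * u.+1%:R != 0 :> R by rewrite -natrM pnatr_eq0; lia.
move: n1 u0; set a := n.+1%:R; set b := n.+2%:R; set c := n.+3%:R.
set d := u%:R * _ => a0 d0.
have -> // : c / a * (2 * (a * b) / d) = 2 * (b * c) / d.
by clearbody a b c d; field; rewrite a0 d0.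
Qed.

End Expectation.

(** * Counting unbalanced splits *)

Section Counting.
Local Open Scope nat_scope.

Lemma count_le_bound M a : \sum_(1 <= r < M.+1) (r <= a) <= a.
Proof.
have : \sum_(1 <= r < M.+1) (r <= a) = minn M a.
  elim: M => [|M IH]; first by rewrite big_geq ?min0n.
  by rewrite big_nat_recr //= IH; case: leqP; lia.
by move=> ->; exact: geq_minr.
Qed.

Lemma count_rev_le_bound M a : \sum_(1 <= r < M.+1) (M.+1 - r <= a) <= a.
Proof.
apply: leq_trans (count_le_bound M a); rewrite [leqRHS]big_nat_rev /=.
by apply: leq_sum => r _; rewrite add1n subSS.
Qed.

(** The factors [r.-1] and [n - s - r] sum to [M]. When n > 4s, also n <= 2M, so the larger factor
    is at least n/4 and a small product forces the other to be at most 4s. This leaves at most 8s +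
    1 <= 9s values of [r]. *)
Lemma count_small_product n s M : 0 < s -> 0 < M -> s + M = n.-1 ->
  n * \sum_(1 <= r < M.+1) (r.-1 * (n - s - r) <= n * s) <= 20 * s * M.
Proof.
move=> s0 M0 sM; have [n4s|n4s] := leqP n (4 * s).
  apply: (@leq_trans (n * M)); last by rewrite leq_mul2r; lia.
  rewrite leq_mul2l; apply/orP; right.
  apply: (@leq_trans (\sum_(1 <= r < M.+1) 1)); last by rewrite sum_nat_const_nat; lia.
  by apply: leq_sum => r _; exact: leq_b1.
apply: (@leq_trans (n * (9 * s))); last first.
  have : n <= 2 * M by lia.
  nia.
rewrite leq_mul2l; apply/orP; right.
apply: (@leq_trans (\sum_(1 <= r < M.+1) ((r <= (4 * s).+1) + (M.+1 - r <= 4 * s)))).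
  rewrite big_nat [leqRHS]big_nat; apply: leq_sum => r rM.
  suff : (r.-1 * (n - s - r) <= n * s) ==> (r <= (4 * s).+1) || (M.+1 - r <= 4 * s).
    by do 3 case: (leq _ _).
  apply/implyP => prod; apply: contraT; rewrite negb_or -!ltnNge => /andP[r4 q4].
  have ij : r.-1 + (n - s - r) = M by lia.
  have i4 : 4 * s < r.-1 by lia.
  have j4 : 4 * s < n - s - r by lia.
  have n2 : n <= 2 * M by lia.
  nia.
rewrite big_split /=.
have := count_le_bound M (4 * s).+1; have := count_rev_le_bound M (4 * s); lia.
Qed.

(** With n = m + 1 and q the integer part of n/h, at most 2q + 1 values of [r] are bad, and h(2q +
    1) <= 3n <= 6m. *)
Lemma count_unbalanced m h : 0 < h <= m.+1 -> 0 < m ->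
  h * \sum_(1 <= r < m.+1) ~~ ((m.+1 <= h * r.-1) && (m.+1 <= h * (m.+1 - r))) <=
  6 * m.
Proof.
move=> hm m0; set q := m.+1 %/ h.
apply: (@leq_trans (h * (2 * q + 1))); last first.
  by have := leq_divM m.+1 h; rewrite -/q; lia.
rewrite leq_mul2l; apply/orP; right.
apply: (@leq_trans (\sum_(1 <= r < m.+1) ((r <= q.+1) + (m.+1 - r <= q)))).
  apply: leq_sum => r _.
  have small i : h * i < m.+1 -> i <= q.
    by move=> him; rewrite leq_divRL; lia.
  rewrite negb_and -!ltnNge.
  have := small r.-1; have := small (m.+1 - r).
  by case: ltnP => _; case: ltnP => _ /=; lia.
rewrite big_split /=.
have := count_le_bound m q.+1; have := count_rev_le_bound m q; lia.
Qed.

(** One of [W] and [m - W] is at least m/2 and the other at least (n + 1)/h, so their product is at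
    least (n + 1)m/(2h). *)
Lemma balanced_product h m n s W :
  n < h * (m - W) -> n < h * W -> W * (m - W) <= n.+1 * s -> m <= 2 * (h * s).
Proof.
move=> b1 b2 hv; set a := m - W in b1 hv.
have [->|ab] : m = 0 \/ a + W = m by rewrite /a; lia.
  by [].
have hv2 : h * (W * a) <= h * (n.+1 * s) by rewrite leq_mul2l hv orbT.
rewrite -(leq_pmul2l (ltn0Sn n)) -ab.
have [le|le] := leqP W a.
  have : n.+1 * a <= h * W * a by rewrite leq_mul2r b2 orbT.
  have : n.+1 * W <= n.+1 * a by rewrite leq_mul2l le orbT.
  lia.
have : n.+1 * W <= h * a * W by rewrite leq_mul2r b1 orbT.
have : n.+1 * a <= n.+1 * W by rewrite leq_mul2l (ltnW le) orbT.
lia.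
Qed.

End Counting.

(** * Tail bound for the rank of the root *)

Section Tail.
Context {R : realType}.
Implicit Types (x : seq nat) (m u h : nat).

Lemma sum_inv_consecutive a b : (0 < a)%N ->
  \sum_(a <= u < b) (u%:R * u.+1%:R)^-1 <= a%:R^-1 :> R.
Proof.
move=> a0; have [ba|ab] := leqP b a; first by rewrite big_geq ?invr_ge0.
rewrite (@eq_big_nat _ _ _ _ _ _ (fun u => - u.+1%:R^-1 - - u%:R^-1)); last first.
  move=> u au; have u0 : u%:R != 0 :> R by rewrite pnatr_eq0; lia.
  have u1 : u.+1%:R != 0 :> R by rewrite pnatr_eq0.
  by rewrite mulrSr in u1 *; field; rewrite u0 u1.
by rewrite telescope_sumr ?(ltnW ab) // opprK addrC lerBlDr lerDl invr_ge0.
Qed.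

Definition balanced h x : bool :=
  let W := subtree_size 2 x in
  ((size x).+1 <= h * (size x - W))%N && ((size x).+1 <= h * W)%N.

(** What B(1) <= B(u) implies through the bounds on both sides, with the common factor 2 removed. *)
Definition heavy u x : bool :=
  let W := subtree_size 2 x in
  (W * (size x - W) <= (size x).+1 * subtree_size u x)%N.

Lemma prob_unbalanced m h : (0 < h <= m.+1)%N -> (0 < m)%N ->
  ev m (fun x => (~~ balanced h x)%:R) <= 6 / h%:R :> R.
Proof.
move=> hm m0.
(* Vertex [m.+3] is absent from the tree: its subtree is empty and its outer part has size R, which
   is thus uniform on [1, m]. *)
pose F (s r : nat) : R :=
  (~~ ((m.+1 <= h * r.-1) && (m.+1 <= h * (m.+1 - r)))%N)%:R.
rewrite (eq_ev _ _ (fun x => F (subtree_size m.+3 x) (outer_size m.+3 x))).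
  rewrite outer_size_uniform // (eq_ev _ _ (fun=> (\sum_(1 <= r < m.+1) F 0%N r) / m%:R)).
    rewrite ev_cst ler_pdivrMr ?ltr0n // mulrAC ler_pdivlMr ?ltr0n; last by lia.
    by rewrite /F -natr_sum -!natrM ler_nat mulnC count_unbalanced.
  by move=> x _ xm; rewrite subtree_size_early ?xm ?subn0.
move=> x _ xm; rewrite /balanced /F; congr (~~ _)%:R.
have := sizes_partition m.+3 x; rewrite subtree_size_early ?xm // add0n.
rewrite (_ : (\sum_(_ <= _ < _) _)%N = subtree_size 2 x); last first.
  by rewrite /subtree_size xm; apply: eq_bigr => v _; rewrite desc_early ?xm.
move=> oW; have -> : subtree_size 2 x = (m.+1 - outer_size m.+3 x)%N by lia.
by have -> : (m - (m.+1 - outer_size m.+3 x) = (outer_size m.+3 x).-1)%N by lia.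
Qed.

Lemma prob_heavy m u h : (2 < u)%N -> (0 < m)%N ->
  ev m (fun x => (balanced h x && heavy u x)%:R) <=
  320 * h%:R / (u%:R * u.+1%:R) :> R.
Proof.
move=> u2 m0.
have m1 : 0 < m.+1%:R :> R by rewrite ltr0n.
pose F (s r : nat) : R := s%:R * (r.-1 * (m.+1 - s - r) <= m.+1 * s)%N%:R.
(* On the event, [balanced_product] gives 4hS >= m + 1. The indicator is thus at most 4hS/(m + 1)
   times that of an unbalanced split, and this extra S produces a second moment. *)
apply: (@le_trans _ _ (ev m (fun x => 4 * h%:R / m.+1%:R *
    F (subtree_size u x) (outer_size u x)))).
  apply: ev_le => x _ xm; rewrite /balanced /heavy xm /F.
  have := outer_size_le u x; have := inner_size_le u x; rewrite xm.
  set s := subtree_size u x; set r := outer_size u x; set W := subtree_size 2 x.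
  move=> sW rW.
  case: (boolP (_ && _)) => [/andP[/andP[b1 b2] hv]|_]; last first.
    by rewrite !mulr_ge0 // invr_ge0.
  (* [m - W] and [W] are lowered to [r.-1] and [m.+1 - s - r], whose split is uniform given [s]. *)
  rewrite (_ : (r.-1 * _ <= _)%N); last first.
    apply: leq_trans hv; rewrite mulnC leq_mul //; lia.
  rewrite mulr1 mulrAC ler_pdivlMr // mul1r -!natrM ler_nat.
  by have := balanced_product _ _ _ _ _ b1 b2 hv; lia.
rewrite evZ outer_size_uniform //.
(* For S > 0 the split has conditional probability at most 20S/(m + 1) of being unbalanced; S is
   raised to S + 1 to match the second moment bound. *)
apply: (@le_trans _ _ (4 * h%:R / m.+1%:R * ev m (fun x => 20 / m.+1%:R *
   ((subtree_size u x)%:R * (subtree_size u x).+1%:R)))).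
  apply: ler_wpM2l; first by rewrite !mulr_ge0 // invr_ge0.
  apply: ev_le => x _ xm.
  have : (subtree_size u x < m)%N by rewrite -xm subtree_size_lt ?xm.
  set s := subtree_size u x => sm.
  have [s0|s0] := posnP s.
    by rewrite s0 big1 ?mul0r ?mulr0 // => r _; rewrite /F mul0r.
  rewrite /F -big_distrr /= -natr_sum ler_pdivrMr ?ltr0n ?subn_gt0 //.
  have := @count_small_product m.+1 s (m - s) s0.
  rewrite subn_gt0 => /(_ sm) -/(_ (subnKC (ltnW sm))) cnt.
  rewrite [leRHS](_ : _ = s%:R * (20 * s.+1%:R * (m - s)%:R / m.+1%:R)); last by ring.
  rewrite ler_wpM2l // ler_pdivlMr // -!natrM ler_nat mulnC.
  by apply: leq_trans cnt _; rewrite leq_mul2r leq_mul2l leqnSn !orbT.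
rewrite evZ.
apply: le_trans (_ : 4 * h%:R / m.+1%:R * (20 / m.+1%:R *
   (2 * (m.+1%:R * m.+2%:R) / (u%:R * u.+1%:R))) <= _).
  by rewrite !ler_wpM2l ?subtree_size_moment2 // !mulr_ge0 // invr_ge0.
have u0 : 0 < u%:R * u.+1%:R :> R by rewrite mulr_gt0 // ltr0n; lia.
rewrite [leLHS](_ : _ = 160 * h%:R * (m.+2%:R / m.+1%:R) / (u%:R * u.+1%:R)); last first.
  move: m1 u0; set a := m.+1%:R; set b := m.+2%:R; set d := u%:R * _ => m1 u0.
  clearbody a b d; field; lra.
rewrite ler_pM2r ?invr_gt0 //.
rewrite (_ : 320 * h%:R = 160 * h%:R * 2); last by ring.
by rewrite ler_wpM2l ?mulr_ge0 // ler_pdivrMr // -natrM ler_nat; lia.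
Qed.

Lemma prob_rank_gt m h : (1 < h <= m.+1)%N ->
  ev m (fun x => (2 * h < rank m.+1 (tree x) 1)%N%:R) <= 326 / h%:R :> R.
Proof.
move=> hm; have m0 : (0 < m)%N by lia.
have h0 : 0 < h%:R :> R by rewrite ltr0n; lia.
(* In a balanced tree, a rank above 2h needs at least h heavy vertices beyond the first h, whence
   the Markov factor 1/h. *)
apply: (@le_trans _ _ (ev m (fun x => (~~ balanced h x)%:R +
   h%:R^-1 * \sum_(h.+1 <= u < m.+2) (balanced h x && heavy u x)%:R))).
  apply: ev_le => x cx xm.
  case: ltnP => [rk|_]; last first.
    by rewrite addr_ge0 // mulr_ge0 ?invr_ge0 ?(ltW h0) // sumr_ge0.
  case: (boolP (balanced h x)) => bx /=; last first.
    by rewrite big1 // mulr0 addr0.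
  rewrite add0r mulrC ler_pdivlMr // mul1r -natr_sum ler_nat.
  have := @rank_le_count m.+1 (tree x) 1 isT.
  rewrite (@big_cat_nat _ _ _ h.+1) /=; [|lia|lia].
  have : (\sum_(1 <= u < h.+1)
    (betweenness m.+1 (tree x) 1 <= betweenness m.+1 (tree x) u) <= h)%N.
    apply: (@leq_trans (\sum_(1 <= u < h.+1) 1)); last by rewrite sum_nat_const_nat; lia.
    by apply: leq_sum => u _; exact: leq_b1.
  suff : (\sum_(h.+1 <= u < m.+2)
    (betweenness m.+1 (tree x) 1 <= betweenness m.+1 (tree x) u) <=
    \sum_(h.+1 <= u < m.+2) heavy u x)%N by lia.
  rewrite big_nat [leqRHS]big_nat; apply: leq_sum => u um.
  case B1u : (betweenness m.+1 (tree x) 1 <= _)%N => //; rewrite lt0b /heavy xm.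
  have := betweenness_root_ge _ cx; rewrite xm => B1.
  have ux : (1 < u <= (size x).+1)%N by rewrite xm; lia.
  have := betweenness_le _ _ cx ux; rewrite xm => Bu.
  by have := leq_trans (leq_trans B1 B1u) Bu; rewrite -mulnA leq_pmul2l.
rewrite evD evZ ev_sum.
have hm1 : (0 < h <= m.+1)%N by lia.
apply: le_trans (lerD (prob_unbalanced _ _ hm1 m0) (ler_wpM2l _ (_ : _ <= 320))) _.
- by rewrite invr_ge0 ltW.
(* The factor h of [prob_heavy] is absorbed by the tail of the series, at most 1/(h + 1). *)
- apply: (@le_trans _ _ (320 * h%:R * \sum_(h.+1 <= u < m.+2) (u%:R * u.+1%:R)^-1)).
    rewrite big_distrr /= big_nat [leRHS]big_nat; apply: ler_sum => u um.
    by apply: prob_heavy => //; lia.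
  apply: le_trans (ler_wpM2l _ (sum_inv_consecutive _ _ _)) _ => //.
  by rewrite ler_pdivrMr ?ltr0n // ler_pM2l ?ltr0n // ler_nat.
- by rewrite [_ * 320]mulrC -mulrDl ler_pM2r ?invr_gt0 //; lra.
Qed.

Lemma prob_rank_le m h : (1 < h <= m.+1)%N ->
  1 - 326 / h%:R <= ev m (fun x => (rank m.+1 (tree x) 1 <= 2 * h)%N%:R) :> R.
Proof.
move=> hm; have := prob_rank_gt _ _ hm.
rewrite lerBlDr -[X in X <= _ + _](ev_cst m) => tail.
apply: le_trans (lerD (lexx _) tail); rewrite -evD; apply: ev_le => x _ _.
by rewrite ltnNge; case: leqP; rewrite /= ?addr0 ?add0r.
Qed.

End Tail.

(** * The law of the random tree *)

(** The newest vertex has a single neighbour, which gives the first letter; erasing its edge leaves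
    the older tree. *)
Lemma tree_inj x y : valid_code x -> valid_code y -> size x = size y ->
  tree x = tree y -> x = y.
Proof.
elim: x y => [|k x IH] [|l y] //= /andP[kb cx] /andP[lb cy] [xy] exy.
have kl : k = l.
  move: (congr1 (fun e : rel nat => e k (size x).+2) exy).
  rewrite /add_edge xy !eqxx orbT => /esym/or3P[/(tree_bound _ _ _ cy)||].
  - by lia.
  - by rewrite andbT => /eqP.
  - by case/andP => _; lia.
rewrite kl; congr cons; apply: IH => //; apply/funext => a; apply/funext => b.
(* Beyond their vertex range both older trees have no edge; within it the new edge is invisible. *)
have out z (c : nat) : valid_code z -> size z = size y -> ((size y).+1 < c)%N ->
    tree z c =1 xpred0.
  move=> cz zy zc d; apply/negP => /(tree_bound _ _ _ cz); lia.
have [yb|b_le] := ltnP (size y).+1 b.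
  by rewrite tree_sym [RHS]tree_sym !out.
have [ya|a_le] := ltnP (size y).+1 a; first by rewrite !out.
move: (congr1 (fun e : rel nat => e a b) exy); rewrite /add_edge xy kl.
rewrite (ltn_eqF (b_le : (b < (size y).+2)%N)) (ltn_eqF (a_le : (a < (size y).+2)%N)).
by rewrite andbF !orbF.
Qed.

(** Newest attachment first, as in the codes of [tree]. *)
Fixpoint attachments {Omega : Type} (X : nat -> Omega -> nat) (m : nat) (w : Omega) :
  seq nat := if m is m'.+1 then X m w :: attachments X m' w else [::].

Lemma size_attachments {Omega : Type} (X : nat -> Omega -> nat) m w :
  size (attachments X m w) = m.
Proof. by elim: m => [//|m /= ->]. Qed.

Section Law.
Context {d : measure_display} {Omega : measurableType d} {R : realType}.
Context (P : probability Omega R) (T : nat -> Omega -> rel nat).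
Context (X : nat -> {RV P >-> nat}) (T1 : forall w, T 1%N w = empty_graph).
Context (XT : forall n, (1 <= n)%N ->
  [/\ forall w, (1 <= X n w <= n)%N,
      forall w, T n.+1 w = add_edge (T n w) (X n w) n.+1,
      forall k, (1 <= k <= n)%N -> P (X n @^-1` [set k]) = ((n%:R : R)^-1)%:E
    & forall (k : nat) (A : set Omega), past T n A ->
        P ((X n @^-1` [set k]) `&` A) = (P (X n @^-1` [set k]) * P A)%E]).

Let code := attachments (fun n => X n : Omega -> nat).

Lemma valid_attachments m w : valid_code (code m w).
Proof.
elim: m => [//|m IH] /=; rewrite size_attachments IH andbT.
by have [+ _ _ _] := XT m.+1 isT; apply.
Qed.

Lemma tree_attachments m w : T m.+1 w = tree (code m w).
Proof.
elim: m => [|m IH]; first by rewrite T1.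
have [_ TS _ _] := XT m.+1 isT.
by rewrite TS IH /= size_attachments.
Qed.

(** By [tree_inj] the event is a countable union of events fixing the value of [T m.+1]. This makes
    it independent of [X m.+1]. *)
Lemma past_attachments m (Q : pred (seq nat)) :
  past T m.+1 [set w | Q (code m w)].
Proof.
rewrite [X in past T m.+1 X](_ : _ = \bigcup_(x : seq nat)
  [set w | [&& Q x, valid_code x & size x == m] /\ T m.+1 w = tree x]).
  apply: (@countable_bigcupT_measurable _ (g_sigma_algebraType [set A |
    exists m0 (t : rel nat), (1 <= m0 <= m.+1)%N /\ A = [set w | T m0 w = t]])) => // x.
  case: (boolP [&& _, _ & _]) => _.
    apply: sub_sigma_algebra; exists m.+1, (tree x); split; first by rewrite leqnn.
    by apply/seteqP; split => [w []//|w].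
  have -> : [set w | false /\ T m.+1 w = tree x] = set0 :> set Omega.
    by rewrite -subset0 => w [].
  exact: measurable0.
apply/seteqP; split => [w Qw|w [x _ [/and3P[Qx cx /eqP xm]]]].
  exists (code m w) => //; split; last exact: tree_attachments.
  by apply/and3P; split; rewrite ?valid_attachments ?size_attachments.
rewrite tree_attachments /= => eqt.
by rewrite (tree_inj (code m w) x) ?valid_attachments ?size_attachments.
Qed.

Lemma attachments_succ m (Q : pred (seq nat)) :
  [set w | Q (code m.+1 w)] = \big[setU/set0]_(k < m.+1)
    (X m.+1 @^-1` [set k.+1] `&` [set w | Q (k.+1 :: code m w)]).
Proof.
rewrite -(bigcup_mkord m.+1 (fun k => X m.+1 @^-1` [set k.+1] `&`
  [set w | Q (k.+1 :: code m w)])).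
apply/seteqP; split => [w /= Qw|w [k _] [/= <-]] //.
have [/(_ w) Xb _ _ _] := XT m.+1 isT.
exists (X m.+1 w).-1; first by rewrite /=; lia.
by rewrite /= prednK; [|lia].
Qed.

Lemma measurable_attachments m (Q : pred (seq nat)) :
  measurable [set w | Q (code m w)].
Proof.
elim: m Q => [|m IH] Q.
  case Q0 : (Q [::]).
    by rewrite (_ : [set _ | _] = setT) //; apply/seteqP; split.
  by rewrite (_ : [set _ | _] = set0) //; apply/seteqP; split => // w /=; rewrite Q0.
rewrite attachments_succ; apply: bigsetU_measurable => k _.
by apply: measurableI; [exact: measurable_funPTI | exact: (IH (fun x => Q (k.+1 :: x)))].
Qed.

(** The event is split over the last attachment, which is uniform and independent of the past; this
    matches one step of [ev]. *)
Lemma prob_attachments m (Q : pred (seq nat)) :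
  P [set w | Q (code m w)] = (ev m (fun x => (Q x)%:R))%:E.
Proof.
elim: m Q => [|m IH] Q.
  rewrite /=; case Q0 : (Q [::]).
    by rewrite (_ : [set _ | _] = setT) ?probability_setT //; apply/seteqP; split.
  rewrite (_ : [set _ | _] = set0) ?measure0 //.
  by apply/seteqP; split => // w /=; rewrite Q0.
rewrite attachments_succ.
rewrite (measure_bigsetU P (F := fun k => X m.+1 @^-1` [set k.+1] `&`
  [set w | Q (k.+1 :: code m w)])); last 2 first.
- move=> k; apply: measurableI; first exact: measurable_funPTI.
  exact: (measurable_attachments m (fun x => Q (k.+1 :: x))).
- by move=> i j _ _ [w [[/= Xi _] [/= Xj _]]]; move: Xj; rewrite Xi => -[].
have [_ _ uX iX] := XT m.+1 isT.
rewrite evS (eq_ev _ _ (fun x => m.+1%:R^-1 * \sum_(k < m.+1) (Q (k.+1 :: x))%:R));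
  last by move=> x _ _; rewrite big_add1 big_mkord mulrC.
rewrite evZ ev_sum big_distrr /= -sumEFin; apply: eq_bigr => k _.
rewrite iX; last exact: (past_attachments m (fun x => Q (k.+1 :: x))).
by rewrite uX ?(IH (fun x => Q (k.+1 :: x))) // ltn_ord.
Qed.

End Law.

Lemma limn_einf_ge {R : realType} (u : nat -> \bar R) (l : \bar R) N :
  (forall n, (N <= n)%N -> (l <= u n)%E) -> (l <= limn_einf u)%E.
Proof.
move=> lu; rewrite limn_einf_lim; apply: lime_ge; first exact: is_cvg_einfs.
exists N => // n /= Nn; apply: le_ereal_inf_tmp => _ [k /= nk <-].
exact/lu/(leq_trans Nn).
Qed.

Theorem corollary21 (R : realType) :
  exists C : R, 0 < C /\
    forall (d : measure_display) (Omega : measurableType d)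
           (P : probability Omega R) (T : nat -> Omega -> rel nat),
      is_URRT P T ->
      forall eps : R, 0 < eps ->
        ((1 - eps)%:E <=
         limn_einf (fun n : nat =>
           P [set w | top_central n (T n w) (C / eps) 1%N]))%E.
Proof.
(* 1304 = 4 * 326: for eps < 1 and h the integer part of K/2, h >= K/4, so that 326/h <= 1304/K =
   eps, while 2h <= K. *)
exists 1304; split; [by rewrite ltr0n|move=> d Omega P T [T1 [X XT]] eps eps0].
have [eps1|eps1] := leP 1 eps.
  by apply: (@limn_einf_ge _ _ _ 0%N) => n _; rewrite (@le_trans _ _ 0%E) // lee_fin; lra.
set K : R := 1304 / eps.
have K1 : 1304 < K by rewrite /K ltr_pdivlMr //; lra.
pose h := Num.truncn (K / 2).
have /andP[hK Kh] : (h%:R <= K / 2 < h.+1%:R)%R by rewrite truncn_itv //; lra.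
rewrite -[h.+1%:R]natr1 in Kh.
have h1 : (1 < h)%N by rewrite -(@ltr_nat R); lra.
apply: (@limn_einf_ge _ _ _ h.+1) => -[//|m] hm.
pose Q x := (rank m.+1 (tree x) 1)%:R <= K.
rewrite (_ : [set w | _] = [set w | Q (attachments (fun n => X n : Omega -> nat) m w)]).
  rewrite (prob_attachments P T X T1 XT) lee_fin.
  apply: (@le_trans _ _ (ev m (fun x => (rank m.+1 (tree x) 1 <= 2 * h)%N%:R))).
    apply: le_trans (prob_rank_le m h _); last by rewrite h1; lia.
    rewrite lerD2l lerN2 ler_pdivrMr; last by rewrite ltr0n; lia.
    have -> : eps = 1304 / K by rewrite /K; field; lra.
    by rewrite mulrAC ler_pdivlMr; lra.
  apply: ev_le => x _ _; rewrite ler_nat /Q.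
  case: leqP => //= rk; rewrite (le_trans (_ : _ <= (2 * h)%:R)) // ?ler_nat //.
  by rewrite natrM; lra.
apply/seteqP; split => w; rewrite /= /top_central /= /Q.
  by rewrite -(tree_attachments P T X T1 XT) => -[].
by rewrite -(tree_attachments P T X T1 XT) => ?; split.
Qed.
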